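(* Let $\ell\in\mathbb{N}$, $p>1$, and let $q$ be the Hölder conjugate of $p$. There exist constants $C_1,C_2>0$ depending only on $p$ and $\ell$ such that the following holds. Suppose that $\mathfrak{g}\in H^\ell$ satisfies $$\nabla^k\mathfrak{g}_n>0\quad\text{for all } n\ge\ell \text{ and } k\in\{0,\dots,\ell\},$$ $$-\Delta_p^{(\ell-k)}\nabla^{k}\mathfrak{g}_{n}\ge 0\quad\text{for all } n\ge\ell \text{ and } k\in\{1,\dots,\ell-1\}.$$ Then for all $u\in\mathcal{H}_0^\ell$, $$\sum_{k=1}^{\ell}R_{k}^{(\ell)}(q;\mathfrak{g},u)\le C_1\left(\sum_{n=\ell}^{\infty}\bigl|\nabla^\ell u_n\bigr|^p-\sum_{n=\ell}^{\infty}\frac{-\Delta_p^{(\ell)}\mathfrak{g}_n}{\mathfrak{g}_n^{p-1}}|u_n|^p\right)$$ and $$\sum_{n=\ell}^{\infty}\bigl|\nabla^\ell u_n\bigr|^p-\sum_{n=\ell}^{\infty}\frac{-\Delta_p^{(\ell)}\mathfrak{g}_n}{\mathfrak{g}_n^{p-1}}|u_n|^p\le C_2\sum_{k=1}^{\ell}R_{k}^{(\ell)}(p;\mathfrak{g},u),$$ where, for $s\in\{p,q\}$ and $k\in\{1,\dots,\ell\}$, $$R_k^{(\ell)}(s;\mathfrak{g},u):=\sum_{n=\ell}^{\infty}\frac{-\Delta_p^{(\ell-k)}\nabla^{k}\mathfrak{g}_{n+1}}{(\nabla^{k}\mathfrak{g}_{n+1})^{p-1}}\,\mathcal{R}(s;\nabla^{k-1}\mathfrak{g},\nabla^{k-1}u)_n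 .$$
   Context: $\mathbb{N}=\{1,2,\dots\}$, and $1/p+1/q=1$. $C(\mathbb{Z})$ is the space of complex sequences indexed by $\mathbb{Z}$, and $C_0(\mathbb{Z})$ its subspace of finitely supported sequences. For $u\in C(\mathbb{Z})$ put $\nabla u_n=(\nabla u)_n:=u_n-u_{n-1}$ and $\mathrm{div}\,u_n=(\mathrm{div}\,u)_n:=u_{n+1}-u_n$, $n\in\mathbb{Z}$; the $0$-th power of an operator is the identity. $H^\ell:=\{u\in C(\mathbb{Z}) : u_n=0 \text{ for all } n<\ell\}$ and $\mathcal{H}_0^\ell:=H^\ell\cap C_0(\mathbb{Z})$. For $\nu\in\mathbb{C}$ and $a>0$, $\nu^{\langle a\rangle}:=\nu|\nu|^{a-1}$ with $0^{\langle a\rangle}:=0$ (applied entrywise to sequences). For an integer $m\ge0$, the discrete $p$-Laplacian of order $m$ is the nonlinear operator $-\Delta_p^{(m)}u:=(-1)^m\,\mathrm{div}^m\bigl((\nabla^m u)^{\langle p-1\rangle}\bigr)$; in particular $-\Delta_p^{(0)}u=u^{\langle p-1\rangle}$. The expression $-\Delta_p^{(m)}\nabla^k\mathfrak{g}_n$ denotes the value at $n$ of $-\Delta_p^{(m)}$ applied to the sequence $\nabla^k\mathfrak{g}$. For a sequence $g$ and a complex sequence $u$, and an index $n$ with $g_n,g_{n+1}>0$, define $$\mathcal{R}(s;g,u)_n:=\begin{cases}\left|\sqrt{\frac{g_{n}}{g_{n+1}}}\,u_{n+1}-\sqrt{\frac{g_{n+1}}{g_{n}}}\,u_{n}\right|^p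 & \text{if } s\in(1,2],\\[6pt] \left|\sqrt{\frac{g_{n}}{g_{n+1}}}\,u_{n+1}-\sqrt{\frac{g_{n+1}}{g_{n}}}\,u_{n}\right|^2\left(|\mathrm{div}\,u_n|+\frac{|u_n|}{g_n}\mathrm{div}\,g_n\right)^{p-2} & \text{if } s\in(2,\infty),\end{cases}$$ with the convention $0^{p-2}:=0$ if $p\in(1,2]$. (The exponents always involve $p$; $s$ only selects the case.) *)

(* Defs.v *)
From HB Require Import structures.
From mathcomp Require Import all_boot all_order all_algebra.
From mathcomp Require Import all_classical all_reals all_analysis.
From mathcomp Require Import complex.

Set Implicit Arguments.
Unset Strict Implicit.
Unset Printing Implicit Defensive.

Import Order.TTheory GRing.Theory Num.Theory.
Import numFieldNormedType.Exports.

Local Open Scope classical_set_scope.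
Local Open Scope ring_scope.
Local Open Scope complex_scope.

Definition nabla (V : zmodType) (u : int -> V) (n : int) : V := u n - u (n - 1).

Definition sdiv (V : zmodType) (u : int -> V) (n : int) : V := u (n + 1) - u n.

(* [normc] is the [R]-valued modulus; the norm [`|z|] of [R[i]] is [R[i]]-valued. *)
Definition modulus (R : realType) (z : R[i]) : R := ComplexField.Normc.normc z.

(* At 0 this is 0 whatever the value of [0 `^ (a - 1)]. *)
Definition spow (R : realType) (a : R) (z : R[i]) : R[i] :=
  z * (modulus z `^ (a - 1))%:C.

(* This is -Delta_p^(m), the minus sign being part of the operator. *)
Definition npLap (R : realType) (p : R) (m : nat) (u : int -> R[i]) (n : int) :
    R[i] :=
  (-1) ^+ m * iter m (@sdiv R[i]) (fun j => spow (p - 1) (iter m (@nabla R[i]) u j)) n.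

Definition Hl (R : realType) (l : nat) : set (int -> R[i]) :=
  [set u | forall n : int, n < l%:Z -> u n = 0].

Definition C0 (R : realType) : set (int -> R[i]) :=
  [set u | finite_set [set n | u n != 0]].

Definition Hl0 (R : realType) (l : nat) : set (int -> R[i]) := @Hl R l `&` @C0 R.

(* [x ^ (p - 2)] with [0 ^ (p - 2) = 0] for every [p]; [powR] alone gives
   [0 `^ 0 = 1] at [p = 2]. *)
Definition pow_sub2 (R : realType) (p x : R) : R :=
  if x == 0 then 0 else x `^ (p - 2).

(* [s] only selects the branch; the exponents involve [p] alone. *)
Definition rem_term (R : realType) (p s : R) (g : int -> R) (u : int -> R[i])
    (n : int) : R :=
  let d := modulus ((Num.sqrt (g n / g (n + 1)))%:C * u (n + 1)
                    - (Num.sqrt (g (n + 1) / g n))%:C * u n) in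
  if s <= 2 then d `^ p
  else d ^+ 2 * pow_sub2 p (modulus (sdiv u n) + modulus (u n) / g n * sdiv g n).

(* The quotient [(-Delta_p^(m) g)_n / g_n ^ (p - 1)] for a complex sequence [g]
   all of whose values are real and nonnegative, so that [complex.Re] loses
   nothing. *)
Definition weight (R : realType) (p : R) (m : nat) (g : int -> R[i]) (n : int) : R :=
  complex.Re (npLap p m g n) / complex.Re (g n) `^ (p - 1).

(* The sum of the series over [n >= l], for a real-valued summand.  Below, the
   summands vanish for large [n] because [u] is finitely supported. *)
Definition sum_from (R : realType) (l : nat) (f : nat -> R) : R :=
  limn (fun N : nat => \sum_(l <= n < N) f n).

Definition remainder (R : realType) (p : R) (l k : nat) (s : R)
    (g u : int -> R[i]) : R :=
  sum_from l (fun n =>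
    weight p (l - k) (iter k (@nabla R[i]) g) (n%:Z + 1)
    * rem_term p s (fun j => complex.Re (iter k.-1 (@nabla R[i]) g j))
        (iter k.-1 (@nabla R[i]) u) n%:Z).

Definition deficit (R : realType) (p : R) (l : nat) (g u : int -> R[i]) : R :=
  sum_from l (fun n => modulus (iter l (@nabla R[i]) u n%:Z) `^ p)
  - sum_from l (fun n => weight p l g n%:Z * modulus (u n%:Z) `^ p).

(* Main.v *)
(** Put [h = nabla^(k-1) g], [v = nabla^(k-1) u] and
    [W = -Delta_p^(l-k) (nabla h)], so that
    [-Delta_p^(l-k+1) h_n = W_n - W_(n+1)].  Summation by parts turns
      [sum_n W_n / (nabla h_n)^(p-1) |nabla v_n|^p
       - sum_n (W_n - W_(n+1)) / h_n^(p-1) |v_n|^p]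
    into a sum of Picone gaps weighted by [W_(n+1) / (nabla h_(n+1))^(p-1)], and
    adding these identities over [k] telescopes to the deficit.  The Picone gap
    of [a = v_n], [b = v_(n+1)], [s = h_n], [t = h_(n+1)] is a multiple of the
    Jensen gap of [|.|^p] at the points [a / s] and [(b - a) / (t - s)] with
    coefficients [s / t] and [1 - s / t].  The Jensen gap is a convex combination
    of two Bregman divergences of [|.|^p], for which sharp two-sided bounds follow
    from Young's and Bernoulli's inequalities. *)

Require Import Defs.
From HB Require Import structures.
From mathcomp Require Import all_boot all_order all_algebra.
From mathcomp Require Import all_classical all_reals all_analysis.
From mathcomp Require Import complex ring lra zify.

Set Implicit Arguments.
Unset Strict Implicit.
Unset Printing Implicit Defensive.

Import Order.TTheory GRing.Theory Num.Theory.
Import numFieldNormedType.Exports.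

Local Open Scope classical_set_scope.
Local Open Scope ring_scope.
Local Open Scope complex_scope.

(** * Convexity and monotonicity inequalities for real powers *)

(** Young's inequality for [r] and [w^(a-1)] with exponents [a] and [a/(a-1)]; at [a = 1] the second
    exponent would be infinite, so that case is separate. *)
Lemma powR_tangent (R : realType) (a r w : R) : 1 <= a -> 0 <= r -> 0 <= w ->
  a * w `^ (a - 1) * (r - w) <= r `^ a - w `^ a.
Proof.
move=> a1 r0 w0; have [->|a1'] := eqVneq a 1.
  by rewrite subrr powRr0 !powRr1// !mul1r.
have {a1 a1'} a1 : 1 < a by rewrite lt_neqAle eq_sym a1'.
have a0 : 0 < a by lra.
have aB : 0 < a - 1 by lra.
have q0 : 0 < a / (a - 1) by rewrite divr_gt0.
have hq : a^-1 + (a / (a - 1))^-1 = 1 by field; lra.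
have := conjugate_powR r0 (powR_ge0 w (a - 1)) a0 q0 hq.
rewrite -powRrM (_ : (a - 1) * (a / (a - 1)) = a); last by field; lra.
rewrite -(ler_pM2l a0) => H.
have E : w * w `^ (a - 1) = w `^ a by rewrite mulr_powRB1.
rewrite mulrBr -!mulrA [w `^ (a - 1) * w]mulrC E.
have E2 : a * (r `^ a / a + w `^ a / (a / (a - 1))) = r `^ a + (a - 1) * w `^ a.
  by field; lra.
move: H; rewrite E2 [w `^ (a - 1) * r]mulrC; lra.
Qed.

(** Young's inequality for [s^a] and [1] with exponents [1/a] and [1/(1-a)]. *)
Lemma powR_bernoulli (R : realType) (a s : R) : 0 < a -> a < 1 -> 0 <= s ->
  s `^ a <= 1 + a * (s - 1).
Proof.
move=> a0 a1 s0.
have a1' : 0 < 1 - a by lra.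
have h : (a^-1)^-1 + ((1 - a)^-1)^-1 = 1 by rewrite !invrK; ring.
have i1 : 0 < a^-1 by rewrite invr_gt0.
have i2 : 0 < (1 - a)^-1 by rewrite invr_gt0.
have := conjugate_powR (powR_ge0 s a) ler01 i1 i2 h.
rewrite -powRrM mulfV ?gt_eqF// powRr1// powR1 !invrK mulr1; lra.
Qed.

Lemma ler_powRl (R : realType) (a x y : R) :
  0 <= a -> 0 <= x -> x <= y -> x `^ a <= y `^ a.
Proof.
by move=> a0 x0 xy; apply: (ge0_ler_powR a0) => //; rewrite nnegrE// (le_trans x0).
Qed.

Lemma ler_powRln (R : realType) (a x y : R) :
  a <= 0 -> 0 < x -> x <= y -> y `^ a <= x `^ a.
Proof.
move=> a0 x0 xy; rewrite -(opprK a) !(powRN _ (- a)).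
by rewrite lef_pV2 ?posrE ?powR_gt0//; [apply: ler_powRl; lra|lra].
Qed.

Lemma sqr_mul_powRB2 (R : realType) (p x : R) : 1 < p -> 0 <= x ->
  x ^+ 2 * x `^ (p - 2) = x `^ p.
Proof.
move=> p1 x0; rewrite -powR_mulrn// -powRD; last by apply/implyP; lra.
by congr powR; ring.
Qed.

Lemma mul_powRB2 (R : realType) (p x : R) : 1 < p -> 0 <= x ->
  x * x `^ (p - 2) = x `^ (p - 1).
Proof. by move=> p1 x0; rewrite -[RHS]mulr_powRB1//; [congr (_ * _ `^ _); ring|lra]. Qed.

(** A ratio [w/x] in [[0,1]] is at most its [a]-th power; adding this for [w = y] and [w = x - y]
    gives subadditivity. *)
Lemma powR_subadd (R : realType) (a x y : R) : 0 < a -> a <= 1 -> 0 <= y -> y <= x ->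
  x `^ a - y `^ a <= (x - y) `^ a.
Proof.
move=> a0 a1 y0 yx.
have [->|x0] := eqVneq x 0.
  by rewrite powR0 ?gt_eqF// sub0r; have := powR_ge0 y a; have := powR_ge0 (0 - y) a; lra.
have {}x0 : 0 < x by rewrite lt_neqAle eq_sym x0 (le_trans y0).
have sub (w : R) : 0 <= w -> w <= x -> w / x * x `^ a <= w `^ a.
  move=> w0 wx; have [->|wn] := eqVneq w 0; first by rewrite !mul0r powR_ge0.
  have {}w0 : 0 < w by rewrite lt_neqAle eq_sym wn.
  have -> : w `^ a = (w / x) `^ a * x `^ a.
    by rewrite -powRM ?divfK ?gt_eqF ?divr_ge0// ltW.
  rewrite ler_wpM2r ?powR_ge0// ger1_powR// divr_gt0//=.
  by rewrite ler_pdivrMr// mul1r.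
have := sub y y0 yx; have := sub (x - y); rewrite mulrBl divff ?gt_eqF// => H1 H2.
have := H1 _ _; rewrite mulrBl; lra.
Qed.

(** * Two-sided bounds for the Bregman divergence of |.|^p *)

(* [bregman p |x| |y| |x - y|] is the Bregman divergence of [|.|^p] from [y] to
   [x] in an inner product space: it equals
   [|x|^p - |y|^p - p |y|^(p-2) <y, x - y>]. *)
Definition bregman (R : realType) (p r w d : R) : R :=
  r `^ p - w `^ p - p / 2 * w `^ (p - 2) * (r ^+ 2 - w ^+ 2 - d ^+ 2).

(** Splits off a radial part, the one-dimensional divergence of the radii, from a transverse part,
    which is nonnegative under the triangle inequalities. Most estimates below treat the two
    separately. *)
Lemma bregmanE (R : realType) (p r w d : R) : 1 < p -> 0 <= w ->
  bregman p r w d = (r `^ p - w `^ p - p * w `^ (p - 1) * (r - w))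
    + p / 2 * w `^ (p - 2) * (d ^+ 2 - (r - w) ^+ 2).
Proof. by move=> p1 w0; rewrite /bregman -(mul_powRB2 p1 w0); field. Qed.

Lemma ler_sqr_norml (R : realType) (x y : R) : - y <= x -> x <= y -> x ^+ 2 <= y ^+ 2.
Proof.
move=> xy yx; have : 0 <= (y - x) * (y + x) by rewrite mulr_ge0//; lra.
by rewrite -subr_sqr subr_ge0.
Qed.

(** Two regimes: while [d] is at most a multiple of [w], a second-order term [w^(p-2) d^2] controls
    [d^p]; beyond it [r] dominates [w], and half of [r^p] absorbs the first-order term. *)
Lemma ler_bregman_ge2 (R : realType) (p : R) : 2 <= p ->
  exists2 c, 0 < c & forall r w d : R, 0 <= r -> 0 <= w -> 0 <= d ->
    d <= r + w -> r <= d + w -> w <= d + r -> c * d `^ p <= bregman p r w d.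
Proof.
move=> p2.
have p1 : 1 < p by lra.
(* Together with [d <= r + w], the inequality [K w < d] forces [2 p w <= r]. *)
set K := 2 * p + 1.
have K0 : 0 < K by rewrite /K; lra.
pose c1 := p / 2 * K^-1 `^ (p - 2).
pose c2 := 2^-1 * 2^-1 `^ p.
have c1_gt0 : 0 < c1 by rewrite mulr_gt0 ?powR_gt0 ?invr_gt0//; lra.
have c2_gt0 : 0 < c2 by rewrite mulr_gt0 ?powR_gt0 ?invr_gt0//; lra.
exists (Num.min c1 c2); first by rewrite lt_min c1_gt0.
move=> r w d r0 w0 d0 dle rle wle.
have [dK|dK] := leP d (K * w).
  apply: (@le_trans _ _ (c1 * d `^ p)).
    by rewrite ler_wpM2r ?powR_ge0// ge_min lexx.
  apply: (@le_trans _ _ (p / 2 * w `^ (p - 2) * d ^+ 2)).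
    rewrite -(sqr_mul_powRB2 p1 d0).
    have -> : c1 * (d ^+ 2 * d `^ (p - 2)) =
      p / 2 * (K^-1 `^ (p - 2) * d `^ (p - 2)) * d ^+ 2 by rewrite /c1; ring.
    rewrite -powRM ?invr_ge0 ?(ltW K0)// ler_wpM2r ?sqr_ge0// ler_wpM2l//.
      by lra.
    apply: ler_powRl; [lra|by rewrite mulr_ge0 ?invr_ge0 ?(ltW K0)|].
    by rewrite ler_pdivrMl.
  (* Convexity of the power [p/2] at the squared radii cancels the first-order terms and leaves
     exactly [p/2 w^(p-2) d^2]. *)
  have := @powR_tangent R (p / 2) (r ^+ 2) (w ^+ 2) _ (sqr_ge0 r) (sqr_ge0 w).
  have sq (x a : R) : 0 <= x -> (x ^+ 2) `^ a = x `^ (2 * a).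
    by move=> x0; rewrite -powR_mulrn// -powRrM.
  rewrite !sq// (_ : 2 * (p / 2) = p); last by field.
  rewrite (_ : 2 * (p / 2 - 1) = p - 2); last by field.
  rewrite /bregman => H; have := H _; lra.
have wd : w <= d.
  apply: le_trans (ltW dK); rewrite ler_peMl// /K; lra.
have rw : 2 * p * w <= r by move: dK; rewrite /K; lra.
have wr : w <= r.
  by apply: le_trans rw; rewrite ler_peMl//; lra.
have dr : d / 2 <= r.
  have : 2 * w <= d by apply: le_trans (ltW dK); rewrite ler_wpM2r// /K; lra.
  lra.
apply: (@le_trans _ _ (c2 * d `^ p)).
  by rewrite ler_wpM2r ?powR_ge0// ge_min lexx orbT.
have -> : c2 * d `^ p = 2^-1 * (d / 2) `^ p.
  by rewrite /c2 -mulrA -powRM ?invr_ge0// [2^-1 * d]mulrC.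
apply: (@le_trans _ _ (2^-1 * r `^ p)).
  by rewrite ler_wpM2l//; apply: ler_powRl => //; lra.
rewrite bregmanE//.
have E0 : 0 <= p / 2 * w `^ (p - 2) * (d ^+ 2 - (r - w) ^+ 2).
  rewrite mulr_ge0// ?mulr_ge0 ?powR_ge0//; first by lra.
  by rewrite subr_ge0 lerXn2r ?nnegrE//; lra.
have H1 : p * w `^ (p - 1) * r <= 2^-1 * r `^ p.
  rewrite -(mul_powRB2 p1 w0) -(sqr_mul_powRB2 p1 r0) expr2.
  have H2 : w `^ (p - 2) <= r `^ (p - 2) by apply: ler_powRl => //; lra.
  have -> : p * (w * w `^ (p - 2)) * r = (p * w) * r * w `^ (p - 2) by ring.
  rewrite mulrA ler_pM ?powR_ge0 ?mulr_ge0//; first by lra.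
  by rewrite mulrA ler_wpM2r//; lra.
have H3 : w `^ p <= p * w `^ p by rewrite ler_peMl ?powR_ge0//; lra.
have H4 : w `^ (p - 1) * w = w `^ p by rewrite mulrC mulr_powRB1//; lra.
move: H3; rewrite -H4 => H3.
have -> : p * w `^ (p - 1) * (r - w) = p * w `^ (p - 1) * r - p * (w `^ (p - 1) * w) by ring.
lra.
Qed.

(** Bernoulli's inequality gives [s^(2-p) <= T], hence [s^p >= s^2 / T]; subtracting the tangent
    line from [s^2 / T] leaves exactly [(p-1)^2 (s-1)^2 / T]. As [T] grows with [s], this serves up
    to a threshold [K], past which [s^p] dominates the linear term. *)
Lemma powR_taylor2_ge (R : realType) (p : R) : 1 < p -> p < 2 ->
  exists2 c, 0 < c & forall s : R, 0 <= s ->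
    c * ((s - 1) ^+ 2 * (s + 1) `^ (p - 2)) <= s `^ p - 1 - p * (s - 1).
Proof.
move=> p1 p2.
(* Chosen so that [K^(p-1) = 2p]: for [s > K] the term [p s] is at most half of [s^p]. *)
pose K := (2 * p) `^ ((p - 1)^-1).
have i0 : 0 < (p - 1)^-1 by rewrite invr_gt0; lra.
have K1 : 1 <= K.
  have := @ler_powRl R ((p - 1)^-1) 1 (2 * p) (ltW i0) ler01.
  by rewrite powR1; apply; lra.
have K0 : 0 < K by lra.
(* [K] bounds [T] on the first range; the 2 gives [c <= 1/2], as the tail retains only half of
   [s^p]. *)
pose c := (p - 1) ^+ 2 / (2 * K).
have c0 : 0 < c by rewrite divr_gt0 ?exprn_gt0//; lra.
have psq : (p - 1) ^+ 2 <= 1 by rewrite -[leRHS](expr1n _ 2) lerXn2r ?nnegrE; lra.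
exists c => // s s0.
have s1 : 0 < s + 1 by lra.
have [sK|Ks] := leP s K.
  pose T := 1 + (2 - p) * (s - 1).
  have TE : T = (p - 1) + (2 - p) * s by rewrite /T; ring.
  have T0 : 0 < T.
    by rewrite TE ltr_pwDl ?mulr_ge0//; lra.
  have TK : T <= K.
    have : (2 - p) * (s - 1) <= (2 - p) * (K - 1) by rewrite ler_wpM2l; lra.
    have : (2 - p) * (K - 1) <= 1 * (K - 1) by rewrite ler_wpM2r; lra.
    rewrite /T; lra.
  have sT : s ^+ 2 / T <= s `^ p.
    rewrite ler_pdivrMr//.
    have -> : s ^+ 2 = s `^ p * s `^ (2 - p).
      rewrite -powR_mulrn// -powRD; first by congr powR; ring.
      by apply/implyP; lra.
    rewrite ler_wpM2l ?powR_ge0//; apply: powR_bernoulli => //; lra.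
  have -> : s `^ p - 1 - p * (s - 1) =
      (s `^ p - s ^+ 2 / T) + ((p - 1) ^+ 2 * (s - 1) ^+ 2) / T.
    by rewrite /T; field; rewrite -/T; lra.
  apply: (@le_trans _ _ (((p - 1) ^+ 2 * (s - 1) ^+ 2) / T)); last by lra.
  have -> : c * ((s - 1) ^+ 2 * (s + 1) `^ (p - 2)) =
      (p - 1) ^+ 2 * (s - 1) ^+ 2 * ((2 * K)^-1 * (s + 1) `^ (p - 2)).
    by rewrite /c; ring.
  rewrite ler_wpM2l ?(mulr_ge0 (sqr_ge0 _) (sqr_ge0 _))//.
  have Q : (s + 1) `^ (p - 2) <= 1.
    by have := @ler_powRln R (p - 2) 1 (s + 1); rewrite powR1; apply; lra.
  apply: (@le_trans _ _ (K^-1)); last by rewrite lef_pV2.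
  rewrite -[leRHS]mulr1 ler_pM ?invr_ge0 ?powR_ge0 ?mulr_ge0 ?(ltW K0)//.
  by rewrite lef_pV2 ?posrE ?mulr_gt0//; lra.
have Sp : 2 * p <= s `^ (p - 1).
  have -> : 2 * p = K `^ (p - 1).
    by rewrite /K -powRrM mulVf ?powRr1//; lra.
  by apply: ler_powRl; lra.
have Sp' : 2 * (p * s) <= s `^ p.
  rewrite -(@mulr_powRB1 _ s p)//; last by lra.
  by rewrite mulrA mulrC ler_wpM2l.
have c2 : c <= 2^-1.
  rewrite /c invfM mulrA ler_pdivrMr//.
  apply: le_trans (_ : 2^-1 * 1 <= _); last by rewrite ler_wpM2l// invr_ge0.
  by rewrite mulrC ler_wpM2l// invr_ge0.
have Q : (s - 1) ^+ 2 * (s + 1) `^ (p - 2) <= s `^ p.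
  rewrite -(sqr_mul_powRB2 p1 s0) ler_pM ?sqr_ge0 ?powR_ge0//.
    by rewrite lerXn2r ?nnegrE; lra.
  by apply: ler_powRln; lra.
apply: (@le_trans _ _ (2^-1 * s `^ p)); last by lra.
by apply: ler_pM => //; [exact: ltW|exact: mulr_ge0 (sqr_ge0 _) (powR_ge0 _ _)].
Qed.

(** After scaling by [w] the radial part is the one-variable estimate at [r/w]; the transverse part
    carries [w^(p-2)], which is at least [(r+w)^(p-2)] because [p < 2]. *)
Lemma ler_bregman_lt2 (R : realType) (p : R) : 1 < p -> p < 2 ->
  exists2 c, 0 < c & forall r w d : R, 0 <= r -> 0 <= w -> 0 <= d ->
    d <= r + w -> r <= d + w -> w <= d + r ->
    c * (d ^+ 2 * (r + w) `^ (p - 2)) <= bregman p r w d.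
Proof.
move=> p1 p2; have [c c0 H] := powR_taylor2_ge p1 p2.
exists (Num.min c (Num.min 1 (p / 2))).
  by rewrite !lt_min c0 ltr01/=; lra.
move=> r w d r0 w0 d0 dle rle wle.
set k := Num.min _ _.
have [kc k1 kp] : [/\ k <= c, k <= 1 & k <= p / 2].
  by rewrite /k; split; rewrite !ge_min lexx ?orbT.
have k0 : 0 <= k by rewrite /k !le_min (ltW c0) ler01/=; lra.
(* At [w = 0] the triangle inequalities force [d = r], and [powR] sends the singular factor
   [w^(p-2)] to 0, so both sides are multiples of [r^p]. *)
have [w00|wn] := eqVneq w 0.
  have rd : d = r by apply/le_anti/andP; split; lra.
  rewrite w00 /bregman addr0 rd !powR0; [|lra|lra].
  rewrite sqr_mul_powRB2// mulr0 mul0r !subr0.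
  by rewrite ler_piMl ?powR_ge0.
have {}w0 : 0 < w by rewrite lt_neqAle eq_sym wn.
rewrite bregmanE ?(ltW w0)//.
have dE : d ^+ 2 = (r - w) ^+ 2 + (d ^+ 2 - (r - w) ^+ 2) by ring.
rewrite [in leLHS]dE mulrDl mulrDr; apply: lerD.
  apply: (@le_trans _ _ (c * ((r - w) ^+ 2 * (r + w) `^ (p - 2)))).
    by rewrite ler_wpM2r// mulr_ge0 ?sqr_ge0 ?powR_ge0.
  have wp0 := powR_gt0 p w0.
  have s0 : 0 <= r / w by rewrite divr_ge0// ltW.
  have -> : r + w = (r / w + 1) * w by field.
  have -> : r - w = (r / w - 1) * w by field.
  rewrite powRM ?(ltW w0)//; last by lra.
  have -> : r `^ p = (r / w) `^ p * w `^ p by rewrite -powRM ?divfK// ltW.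
  have E1 := sqr_mul_powRB2 p1 (ltW w0).
  have E2 : w `^ (p - 1) * w = w `^ p by rewrite mulrC mulr_powRB1 ?(ltW w0)//; lra.
  have -> : c * (((r / w - 1) * w) ^+ 2 * ((r / w + 1) `^ (p - 2) * w `^ (p - 2))) =
    (c * ((r / w - 1) ^+ 2 * (r / w + 1) `^ (p - 2))) * (w ^+ 2 * w `^ (p - 2)) by ring.
  have -> : p * w `^ (p - 1) * ((r / w - 1) * w) =
    p * (r / w - 1) * (w `^ (p - 1) * w) by ring.
  rewrite E1 E2.
  have -> : (r / w) `^ p * w `^ p - w `^ p - p * (r / w - 1) * w `^ p =
    ((r / w) `^ p - 1 - p * (r / w - 1)) * w `^ p by ring.
  by rewrite ler_wpM2r ?(ltW wp0)// H.
have E0 : 0 <= d ^+ 2 - (r - w) ^+ 2.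
  by rewrite subr_ge0 ler_sqr_norml//; lra.
rewrite [leLHS]mulrCA [leRHS]mulrC ler_wpM2l// ler_pM ?powR_ge0//.
by apply: ler_powRln; lra.
Qed.

(** The tangent inequality taken at [r] instead of [w] replaces the radial part by a symmetric
    product, to be bounded through the power [p-1] alone. *)
Lemma bregman_le_powRB1 (R : realType) (p r w d : R) : 1 < p -> 0 <= r -> 0 <= w ->
  bregman p r w d <= p * ((r `^ (p - 1) - w `^ (p - 1)) * (r - w))
    + p / 2 * w `^ (p - 2) * (d ^+ 2 - (r - w) ^+ 2).
Proof.
move=> p1 r0 w0; rewrite bregmanE// lerD2r.
have := powR_tangent (ltW p1) w0 r0; lra.
Qed.

(** Radially, the power [p-1] is subadditive. Transversally, [d <= w] gives [w^(p-2) <= d^(p-2)],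
    while for [w <= d] the difference of squares factors into terms at most [2w] and [2d]; hence the
    4 in the constant. *)
Lemma bregman_le2 (R : realType) (p : R) : 1 < p -> p <= 2 ->
  exists2 c, 0 < c & forall r w d : R, 0 <= r -> 0 <= w -> 0 <= d ->
    d <= r + w -> r <= d + w -> w <= d + r -> bregman p r w d <= c * d `^ p.
Proof.
move=> p1 p2; exists (p + p / 2 * 4); first by lra.
move=> r w d r0 w0 d0 dle rle wle.
apply: (le_trans (bregman_le_powRB1 d p1 r0 w0)).
have rwd : `|r - w| <= d by rewrite ler_norml; apply/andP; split; lra.
rewrite [leRHS]mulrDl; apply: lerD.
  rewrite ler_pM2l; last by lra.
  apply: (@le_trans _ _ (`|r - w| `^ p)); last by apply: ler_powRl => //; lra.
  rewrite -[leRHS]mulr_powRB1//; last by lra.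
  have [h|/ltW h] := leP w r.
    rewrite ger0_norm ?subr_ge0// mulrC ler_wpM2l ?subr_ge0//.
    by apply: powR_subadd => //; lra.
  rewrite ler0_norm ?subr_le0// opprB -mulrNN !opprB mulrC ler_wpM2l ?subr_ge0//.
  by apply: powR_subadd => //; lra.
rewrite -!mulrA ler_wpM2l//; first by lra.
rewrite ler_wpM2l ?invr_ge0//.
have [wn|wn] := eqVneq w 0.
  have rd : d = r by apply/le_anti/andP; split; lra.
  by rewrite wn rd subr0 subrr mulr0 mulr_ge0 ?powR_ge0.
have {wn}w0' : 0 < w by rewrite lt_neqAle eq_sym wn.
have [dw|/ltW wd] := leP d w.
  have [->|dn] := eqVneq d 0.
    rewrite expr0n sub0r; apply: (@le_trans _ _ 0); last by rewrite mulr_ge0 ?powR_ge0.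
    by rewrite mulrN oppr_le0 mulr_ge0 ?powR_ge0 ?sqr_ge0.
  have d0' : 0 < d by rewrite lt_neqAle eq_sym dn.
  apply: (@le_trans _ _ (d `^ p)); last by rewrite ler_peMl ?powR_ge0//; lra.
  rewrite -(sqr_mul_powRB2 p1 d0) mulrC ler_pM ?powR_ge0//.
  - by rewrite subr_ge0 ler_sqr_norml//; lra.
  - by rewrite lerBlDr lerDl sqr_ge0.
  - by apply: ler_powRln; lra.
apply: (@le_trans _ _ (w `^ (p - 2) * (4 * (w * d)))).
  rewrite ler_wpM2l ?powR_ge0// subr_sqr.
  have -> : 4 * (w * d) = (2 * w) * (2 * d) by ring.
  by rewrite ler_pM//; lra.
have -> : w `^ (p - 2) * (4 * (w * d)) = 4 * (d * (w * w `^ (p - 2))) by ring.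
rewrite mul_powRB2// ler_wpM2l//.
rewrite -(@mulr_powRB1 _ d p)//; last by lra.
by rewrite ler_wpM2l// ler_powRl//; lra.
Qed.

(** The power [p-1] is now convex, so its tangent at the larger radius bounds the radial part;
    transversally [w^(p-2) <= (r+w)^(p-2)]. *)
Lemma bregman_gt2 (R : realType) (p : R) : 2 < p ->
  exists2 c, 0 < c & forall r w d : R, 0 <= r -> 0 <= w -> 0 <= d ->
    d <= r + w -> r <= d + w -> w <= d + r ->
    bregman p r w d <= c * (d ^+ 2 * (r + w) `^ (p - 2)).
Proof.
move=> p2; have p1 : 1 < p by lra.
exists (p * (p - 1) + p / 2).
  by rewrite addr_gt0 ?mulr_gt0//; lra.
move=> r w d r0 w0 d0 dle rle wle.
apply: (le_trans (bregman_le_powRB1 d p1 r0 w0)).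
have rwd : (r - w) ^+ 2 <= d ^+ 2 by apply: ler_sqr_norml; lra.
have B (x y : R) : 0 <= x -> 0 <= y -> x <= y ->
    (x `^ (p - 1) - y `^ (p - 1)) * (x - y) <=
    (p - 1) * ((x - y) ^+ 2 * (x + y) `^ (p - 2)).
  move=> x0 y0 xy.
  have := @powR_tangent R (p - 1) x y _ x0 y0.
  rewrite (_ : p - 1 - 1 = p - 2); last by ring.
  move=> /(_ ltac:(lra)) H.
  have H2 : y `^ (p - 2) <= (x + y) `^ (p - 2) by apply: ler_powRl; lra.
  have -> : (x `^ (p - 1) - y `^ (p - 1)) * (x - y) =
    (y `^ (p - 1) - x `^ (p - 1)) * (y - x) by ring.
  have -> : (p - 1) * ((x - y) ^+ 2 * (x + y) `^ (p - 2)) =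
    (p - 1) * (x + y) `^ (p - 2) * (y - x) * (y - x) by ring.
  rewrite ler_wpM2r; [by []|lra|].
  apply: (@le_trans _ _ ((p - 1) * y `^ (p - 2) * (y - x))); first by lra.
  by rewrite ler_wpM2r ?ler_wpM2l//; lra.
rewrite [leRHS]mulrDl; apply: lerD.
  rewrite -[leRHS]mulrA ler_pM2l; last by lra.
  apply: (@le_trans _ _ ((p - 1) * ((r - w) ^+ 2 * (r + w) `^ (p - 2)))).
    have [h|/ltW h] := leP r w; first exact: B.
    by have := B _ _ w0 r0 h; rewrite [w + r]addrC -sqrrN opprB -mulrNN !opprB.
  by rewrite ler_pM2l; [rewrite ler_wpM2r ?powR_ge0|lra].
rewrite -mulrA ler_pM2l; last by lra.
rewrite mulrC ler_pM ?powR_ge0//; first by rewrite subr_ge0.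
  by rewrite lerBlDr lerDl sqr_ge0.
by apply: ler_powRl => //; lra.
Qed.

(** * The complex modulus *)

Lemma modulus_ge0 (R : realType) (z : R[i]) : 0 <= modulus z.
Proof. by case: z => a b; rewrite /modulus /= sqrtr_ge0. Qed.

Lemma sqr_modulus (R : realType) (z : R[i]) :
  modulus z ^+ 2 = complex.Re z ^+ 2 + complex.Im z ^+ 2.
Proof. by case: z => a b; rewrite /modulus /= sqr_sqrtr// addr_ge0 ?sqr_ge0. Qed.

Lemma modulus_scale (R : realType) (a : R) (z : R[i]) : 0 <= a ->
  modulus (a%:C * z) = a * modulus z.
Proof.
move=> a0; rewrite /modulus ComplexField.Normc.normcM; congr (_ * _).
by rewrite /= expr0n/= addr0 sqrtr_sqr ger0_norm.
Qed.

Lemma modulus_triangle (R : realType) (x y : R[i]) :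
  [/\ modulus (x - y) <= modulus x + modulus y,
      modulus x <= modulus (x - y) + modulus y &
      modulus y <= modulus (x - y) + modulus x].
Proof.
rewrite /modulus; split.
- by rewrite -(normcN y) le_normcD.
- by rewrite -[in leLHS](subrK y x) le_normcD.
- by rewrite -(normcN (x - y)) -[in leLHS](subrK x y) opprB le_normcD.
Qed.

Lemma modulus_real (R : realType) (a : R) : 0 <= a -> modulus a%:C = a.
Proof. by move=> a0; rewrite /modulus /= expr0n/= addr0 sqrtr_sqr ger0_norm. Qed.

(** * The Jensen gap of |.|^p at two points *)

Section JensenGap.
Variables (R : realType) (p t : R) (x z : R[i]).
Hypotheses (p1 : 1 < p) (t0 : 0 <= t) (t1 : t <= 1).

Let m := t%:C * x + (1 - t)%:C * z.

Definition jensen_gap :=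
  t * modulus x `^ p + (1 - t) * modulus z `^ p - modulus m `^ p.

Lemma modulus_subl : modulus (x - m) = (1 - t) * modulus (z - x).
Proof.
rewrite -modulus_scale ?subr_ge0// -[LHS]normcN; congr modulus.
by rewrite /m; case: x => a b; case: z => c d; simpc; congr (_ +i* _); ring.
Qed.

Lemma modulus_subr : modulus (z - m) = t * modulus (z - x).
Proof.
rewrite -modulus_scale//; congr modulus.
by rewrite /m; case: x => a b; case: z => c d; simpc; congr (_ +i* _); ring.
Qed.

Lemma modulus_conv_le : modulus m <= modulus x + modulus z.
Proof.
apply: (@le_trans _ _ (t * modulus x + (1 - t) * modulus z)).
  rewrite -!modulus_scale ?subr_ge0//.
  exact: le_normcD.
by apply: lerD; rewrite ler_piMl ?modulus_ge0// gerBl.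
Qed.

(* The first-order terms of the two divergences cancel, since
   [t (x - m) + (1 - t) (z - m) = 0]. *)
Lemma jensen_gapE : jensen_gap =
  t * bregman p (modulus x) (modulus m) (modulus (x - m)) +
  (1 - t) * bregman p (modulus z) (modulus m) (modulus (z - m)).
Proof.
(* Stewart's theorem for the point [m] on the segment from [x] to [z]. *)
have M2 : modulus m ^+ 2 = t * modulus x ^+ 2 + (1 - t) * modulus z ^+ 2
    - t * (1 - t) * modulus (z - x) ^+ 2.
  by rewrite !sqr_modulus /m; case: x => a b; case: z => c d; simpc => /=; ring.
rewrite modulus_subl modulus_subr /bregman M2 /jensen_gap; ring.
Qed.

End JensenGap.

(** The two divergences add up to [t(1-t) (t^(p-1) + (1-t)^(p-1)) |z-x|^p], up to a constant, and
    one of [t], [1-t] is at least 1/2. *)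
Lemma jensen_gap_ge2 (R : realType) (p : R) : 2 <= p ->
  exists2 c, 0 < c & forall t x z, 0 <= t -> t <= 1 ->
    c * (t * (1 - t) * modulus (z - x) `^ p) <= jensen_gap p t x z.
Proof.
move=> p2; have p1 : 1 < p by lra.
have [c c0 H] := ler_bregman_ge2 p2.
exists (c * 2^-1 `^ (p - 1)); first by rewrite mulr_gt0 ?powR_gt0// invr_gt0.
move=> t x z t0 t1; rewrite jensen_gapE//.
set m := t%:C * x + _.
have B y : c * modulus (y - m) `^ p <= bregman p (modulus y) (modulus m) (modulus (y - m)).
  by have [] := modulus_triangle y m => ? ? ?; apply: H; rewrite ?modulus_ge0 // [X in _ <= X]addrC.
have := B x; have := B z; rewrite modulus_subl// modulus_subr//.
rewrite !powRM ?modulus_ge0//; last by lra.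
move: (modulus _ `^ p) (powR_ge0 (modulus (z - x)) p) => D D0 Bz Bx.
have s0 : 0 <= 1 - t by lra.
have := lerD (ler_wpM2l t0 Bx) (ler_wpM2l s0 Bz); apply: le_trans.
have pm : 0 < p by lra.
rewrite -(mulr_powRB1 t0 pm) -(mulr_powRB1 s0 pm).
have K : 2^-1 `^ (p - 1) <= t `^ (p - 1) + (1 - t) `^ (p - 1).
  have [h|h] := leP t 2^-1.
    have := @ler_powRl R (p - 1) 2^-1 (1 - t); have := powR_ge0 t (p - 1).
    by move=> ? /(_ ltac:(lra) ltac:(by rewrite invr_ge0) ltac:(lra)); lra.
  have := @ler_powRl R (p - 1) 2^-1 t; have := powR_ge0 (1 - t) (p - 1).
  by move=> ? /(_ ltac:(lra) ltac:(by rewrite invr_ge0) ltac:(lra)); lra.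
have : 0 <= c * (t * (1 - t) * D) by rewrite !mulr_ge0// ltW.
move=> /ler_wpM2l /(_ _ _ K); rewrite mulrDr; lra.
Qed.

Lemma jensen_gap_le2 (R : realType) (p : R) : 1 < p -> p <= 2 ->
  exists2 c, 0 < c & forall t x z, 0 <= t -> t <= 1 ->
    jensen_gap p t x z <= c * (t * (1 - t) * modulus (z - x) `^ p).
Proof.
move=> p1 p2.
have [c c0 H] := bregman_le2 p1 p2.
exists (c * 2); first by rewrite mulr_gt0.
move=> t x z t0 t1; rewrite jensen_gapE//.
set m := t%:C * x + _.
have B y : bregman p (modulus y) (modulus m) (modulus (y - m)) <= c * modulus (y - m) `^ p.
  by have [] := modulus_triangle y m => ? ? ?; apply: H; rewrite ?modulus_ge0 // [X in _ <= X]addrC.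
have := B x; have := B z; rewrite modulus_subl// modulus_subr//.
rewrite !powRM ?modulus_ge0//; last by lra.
move: (modulus _ `^ p) (powR_ge0 (modulus (z - x)) p) => D D0 Bz Bx.
have s0 : 0 <= 1 - t by lra.
have := lerD (ler_wpM2l t0 Bx) (ler_wpM2l s0 Bz) => /le_trans; apply.
have pm : 0 < p by lra.
rewrite -(mulr_powRB1 t0 pm) -(mulr_powRB1 s0 pm).
have K : t `^ (p - 1) + (1 - t) `^ (p - 1) <= 2.
  have := @ler_powRl R (p - 1) t 1; have := @ler_powRl R (p - 1) (1 - t) 1.
  rewrite powR1 => /(_ ltac:(lra) ltac:(lra) ltac:(lra)) ?.
  by move=> /(_ ltac:(lra) ltac:(lra) ltac:(lra)); lra.
have : 0 <= c * (t * (1 - t) * D) by rewrite !mulr_ge0// ltW.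
move=> /ler_wpM2l /(_ _ _ K); rewrite mulrDr; lra.
Qed.

(** Each divergence has weight at least [(2S)^(p-2)], since [|x|], [|z|] and [|m|] are at most
    [S = |x| + |z|]; the coefficients then combine exactly, as [t(1-t)^2 + (1-t)t^2 = t(1-t)]. *)
Lemma jensen_gap_lt2 (R : realType) (p : R) : 1 < p -> p < 2 ->
  exists2 c, 0 < c & forall t x z, 0 <= t -> t <= 1 ->
    c * (t * (1 - t) * (modulus (z - x) ^+ 2 * (modulus x + modulus z) `^ (p - 2)))
      <= jensen_gap p t x z.
Proof.
move=> p1 p2; have [c c0 H] := ler_bregman_lt2 p1 p2.
exists (c * 2 `^ (p - 2)); first by rewrite mulr_gt0 ?powR_gt0.
move=> t x z t0 t1; rewrite jensen_gapE//.
set m := t%:C * x + _.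
set S := modulus x + modulus z.
have S0 : 0 <= S by rewrite addr_ge0 ?modulus_ge0.
have mS : modulus m <= S by exact: modulus_conv_le.
have B y : modulus y <= S -> c * (modulus (y - m) ^+ 2 * (2 `^ (p - 2) * S `^ (p - 2))) <=
    bregman p (modulus y) (modulus m) (modulus (y - m)).
  move=> yS; have [h1 h2 h3] := modulus_triangle y m.
  apply: (@le_trans _ _ (c * (modulus (y - m) ^+ 2 * (modulus y + modulus m) `^ (p - 2)))); last first.
    by apply: H; rewrite ?modulus_ge0.
  rewrite ler_pM2l// -powRM//.
  (* Negative powers are antitone only away from 0, where [powR] returns 0; there the distance
     vanishes too. *)
  have [E|E] := eqVneq (modulus y + modulus m) 0.
    have -> : modulus (y - m) = 0.
      by apply/le_anti/andP; split; rewrite ?modulus_ge0// -E.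
    by rewrite expr0n !mul0r.
  have E0 : 0 < modulus y + modulus m.
    by rewrite lt_neqAle eq_sym E addr_ge0 ?modulus_ge0.
  by rewrite ler_wpM2l ?sqr_ge0// ler_powRln//; lra.
have := B x; have := B z; rewrite modulus_subl// modulus_subr//.
move=> /(_ ltac:(by rewrite lerDr modulus_ge0)) Bz.
move=> /(_ ltac:(by rewrite lerDl modulus_ge0)) Bx.
have s0 : 0 <= 1 - t by lra.
have := lerD (ler_wpM2l t0 Bx) (ler_wpM2l s0 Bz); apply: le_trans.
by rewrite le_eqVlt; apply/orP; left; apply/eqP; ring.
Qed.

Lemma jensen_gap_gt2 (R : realType) (p : R) : 2 < p ->
  exists2 c, 0 < c & forall t x z, 0 <= t -> t <= 1 ->
    jensen_gap p t x z <=
    c * (t * (1 - t) * (modulus (z - x) ^+ 2 * (modulus x + modulus z) `^ (p - 2))).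
Proof.
move=> p2; have p1 : 1 < p by lra.
have [c c0 H] := bregman_gt2 p2.
exists (c * 2 `^ (p - 2)); first by rewrite mulr_gt0 ?powR_gt0.
move=> t x z t0 t1; rewrite jensen_gapE//.
set m := t%:C * x + _.
set S := modulus x + modulus z.
have S0 : 0 <= S by rewrite addr_ge0 ?modulus_ge0.
have mS : modulus m <= S by exact: modulus_conv_le.
have B y : modulus y <= S -> bregman p (modulus y) (modulus m) (modulus (y - m)) <=
    c * (modulus (y - m) ^+ 2 * (2 `^ (p - 2) * S `^ (p - 2))).
  move=> yS; have [h1 h2 h3] := modulus_triangle y m.
  apply: (@le_trans _ _ (c * (modulus (y - m) ^+ 2 * (modulus y + modulus m) `^ (p - 2)))).
    by apply: H; rewrite ?modulus_ge0.
  rewrite ler_pM2l// -powRM// ler_wpM2l ?sqr_ge0//.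
  have y0 := modulus_ge0 y; have m0 := modulus_ge0 m.
  by apply: ler_powRl; lra.
have := B x; have := B z; rewrite modulus_subl// modulus_subr//.
move=> /(_ ltac:(by rewrite lerDr modulus_ge0)) Bz.
move=> /(_ ltac:(by rewrite lerDl modulus_ge0)) Bx.
have s0 : 0 <= 1 - t by lra.
have := lerD (ler_wpM2l t0 Bx) (ler_wpM2l s0 Bz) => /le_trans; apply.
by rewrite le_eqVlt; apply/orP; left; apply/eqP; ring.
Qed.

(** * The Picone gap and its comparison with the remainder terms *)

Definition picone_gap (R : realType) (p s t : R) (a b : R[i]) : R :=
  modulus (b - a) `^ p - (t - s) `^ (p - 1) *
    (modulus b `^ p / t `^ (p - 1) - modulus a `^ p / s `^ (p - 1)).

Lemma modulus_div_scale (R : realType) (c : R) (z : R[i]) : 0 < c ->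
  modulus z = c * modulus (c^-1%:C * z).
Proof.
by move=> c0; rewrite modulus_scale ?invr_ge0 ?(ltW c0)// mulVKf// gt_eqF.
Qed.

Lemma powR_div_powRB1 (R : realType) (p c y : R) : 1 < p -> 0 < c -> 0 <= y ->
  (c * y) `^ p / c `^ (p - 1) = c * y `^ p.
Proof.
move=> p1 c0 y0; rewrite powRM ?(ltW c0)// -(@mulr_powRB1 _ c) ?(ltW c0)//; last by lra.
by have := powR_gt0 (p - 1) c0 => ?; field; rewrite gt_eqF.
Qed.

(* The difference quotients [a / s] and [(b - a) / (t - s)] have [b / t] as
   their convex combination with coefficients [s / t] and [1 - s / t]. *)
Lemma picone_gapE (R : realType) (p s t : R) (a b : R[i]) : 1 < p -> 0 < s -> s < t ->
  picone_gap p s t a b = (t - s) `^ (p - 1) * t *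
    jensen_gap p (s / t) (s^-1%:C * a) ((t - s)^-1%:C * (b - a)).
Proof.
move=> p1 s0 st; have t0 : 0 < t by lra.
have ts0 : 0 < t - s by lra.
rewrite /jensen_gap.
have -> : (s / t)%:C * (s^-1%:C * a) + (1 - s / t)%:C * ((t - s)^-1%:C * (b - a)) =
    t^-1%:C * b.
  rewrite !mulrA -!rmorphM /=.
  have -> : s / t * s^-1 = t^-1 by field; lra.
  have -> : (1 - s / t) * (t - s)^-1 = t^-1 by field; lra.
  by rewrite -mulrDr addrC subrK.
rewrite /picone_gap (modulus_div_scale b t0) (modulus_div_scale a s0).
rewrite (modulus_div_scale (b - a) ts0).
rewrite !powR_div_powRB1 ?modulus_ge0//.
rewrite powRM ?(ltW ts0) ?modulus_ge0// -(@mulr_powRB1 _ (t - s)) ?(ltW ts0)//; last by lra.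
by field; lra.
Qed.

(** Factoring out [sqrt(s/t)] leaves [b - (t/s) a], so the remainder measures the distance between
    the two quotients of the Jensen gap. *)
Lemma modulus_sqrt_ratio (R : realType) (s t : R) (a b : R[i]) : 0 < s -> s < t ->
  modulus ((Num.sqrt (s / t))%:C * b - (Num.sqrt (t / s))%:C * a) =
  Num.sqrt (s / t) * (t - s) * modulus ((t - s)^-1%:C * (b - a) - s^-1%:C * a).
Proof.
move=> s0 st; have t0 : 0 < t by lra.
have ts0 : 0 < t - s by lra.
have r0 : 0 <= t / s by rewrite divr_ge0// ltW.
have -> : Num.sqrt (t / s) = Num.sqrt (s / t) * (t / s).
  transitivity (Num.sqrt (s / t * (t / s) ^+ 2)).
    by congr Num.sqrt; field; lra.
  by rewrite sqrtrM ?divr_ge0 ?ltW// sqrtr_sqr ger0_norm.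
rewrite -[RHS]mulrA.
rewrite rmorphM /= -mulrA -mulrBr modulus_scale ?sqrtr_ge0//; congr (_ * _).
rewrite -[in RHS]modulus_scale ?(ltW ts0)//; congr modulus.
rewrite mulrBr !mulrA -!rmorphM /= mulfV ?gt_eqF// mul1r.
have -> : t / s = 1 + (t - s) / s by field; lra.
by rewrite rmorphD /= mulrDl mul1r opprD addrA.
Qed.

(** The two conventions for the power [p-2] can differ only at [y = 0], where the factor [d]
    vanishes. *)
Lemma sqr_mul_pow_sub2 (R : realType) (p d y : R) : 0 <= d -> d <= y ->
  d ^+ 2 * pow_sub2 p y = d ^+ 2 * y `^ (p - 2).
Proof.
move=> d0 dy; rewrite /pow_sub2; case: eqVneq => // y0.
by rewrite (_ : d = 0) ?expr0n ?mul0r//; apply/le_anti; rewrite d0 -y0 dy.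
Qed.

Section RemTerm.
Variables (R : realType) (p : R) (g : int -> R) (u : int -> R[i]) (n : int).
Hypotheses (p1 : 1 < p) (g0 : 0 < g n) (gS : g n < g (n + 1)).

Let s := g n.
Let t := g (n + 1).
Let x := s^-1%:C * u n.
Let z := (t - s)^-1%:C * (u (n + 1) - u n).

(** Expresses the remainder through the same points [x] and [z] as [picone_gapE], so that the Jensen
    bounds apply. *)
Lemma rem_term_le2 (e : R) : e <= 2 ->
  rem_term p e g u n = Num.sqrt (s / t) `^ p * ((t - s) `^ p * modulus (z - x) `^ p).
Proof.
move=> e2; have ts0 : 0 <= t - s by rewrite subr_ge0 ltW.
rewrite /rem_term e2 modulus_sqrt_ratio// -/s -/t -/x -/z -mulrA.
by rewrite !powRM ?mulr_ge0 ?sqrtr_ge0 ?modulus_ge0.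
Qed.

Lemma rem_term_gt2 (e : R) : 2 < e ->
  rem_term p e g u n = s / t * ((t - s) `^ p *
    (modulus (z - x) ^+ 2 * (modulus x + modulus z) `^ (p - 2))).
Proof.
move=> e2; have ts0 : 0 < t - s by rewrite subr_gt0.
have s0 : 0 < s by []. have t0 : 0 < t by exact: lt_trans gS.
have mz := modulus_ge0 z; have mx := modulus_ge0 x.
rewrite /rem_term leNgt e2 /= modulus_sqrt_ratio// -/s -/t -/x -/z.
have -> : modulus (sdiv u n) + modulus (u n) / s * sdiv g n =
    (t - s) * (modulus x + modulus z).
  rewrite /sdiv -/s -/t (modulus_div_scale (u n) s0) -/x.
  rewrite (modulus_div_scale (u (n + 1) - u n) ts0) -/z.
  by field; rewrite gt_eqF.
have zx : modulus (z - x) <= modulus x + modulus z.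
  by have [+ _ _] := modulus_triangle z x; rewrite [modulus x + _]addrC.
have d0 : 0 <= (t - s) * modulus (z - x) by rewrite mulr_ge0 ?modulus_ge0 ?ltW.
have dS : (t - s) * modulus (z - x) <= (t - s) * (modulus x + modulus z).
  by rewrite ler_wpM2l// ltW.
rewrite -mulrA exprMn -[LHS]mulrA sqr_mul_pow_sub2//.
rewrite sqr_sqrtr ?divr_ge0 ?(ltW s0) ?(ltW t0)//.
rewrite powRM ?(ltW ts0) ?addr_ge0// -(@sqr_mul_powRB2 _ p (t - s)) ?(ltW ts0)//.
by ring.
Qed.

End RemTerm.

(** Converts the prefactor of [picone_gapE], times the Jensen coefficients, into the prefactor of
    [rem_term_gt2]. *)
Lemma picone_gap_weight (R : realType) (p s t X : R) : 1 < p -> 0 < s -> s < t ->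
  (t - s) `^ (p - 1) * t * (s / t * (1 - s / t) * X) = s / t * ((t - s) `^ p * X).
Proof.
move=> p1 s0 st; rewrite -(@mulr_powRB1 _ (t - s) p); [|by rewrite subr_ge0 ltW|lra].
by field; lra.
Qed.

Lemma sqrt_powR (R : realType) (p x : R) : 0 <= x -> Num.sqrt x `^ p = x `^ (2^-1 * p).
Proof. by move=> x0; rewrite -powR12_sqrt// -powRrM. Qed.

(** Since [q <= 2] exactly when [p >= 2], the parameter [q] selects the branch matching the lower
    Jensen bound. The prefactors agree in the quadratic branch; in the other, [(s/t)^(p/2) <= s/t]
    because [s/t <= 1 <= p/2]. *)
Lemma rem_term_le_picone_gap (R : realType) (p q : R) : 1 < p -> p^-1 + q^-1 = 1 ->
  exists2 C, 0 < C & forall (g : int -> R) (u : int -> R[i]) (n : int),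
    0 < g n -> g n < g (n + 1) ->
    rem_term p q g u n <= C * picone_gap p (g n) (g (n + 1)) (u n) (u (n + 1)).
Proof.
move=> p1 pq.
have qE : q = p / (p - 1).
  apply: invr_inj; rewrite -[LHS](addKr p^-1) pq; field; lra.
have [p2|p2] := leP 2 p.
  have q2 : q <= 2 by rewrite qE ler_pdivrMr; lra.
  have [c c0 H] := jensen_gap_ge2 p2.
  exists c^-1; first by rewrite invr_gt0.
  move=> g u n g0 gS; rewrite ler_pdivlMl//.
  have t0 : 0 < g (n + 1) by exact: lt_trans gS.
  have st0 : 0 < g n / g (n + 1) by rewrite divr_gt0.
  have st1 : g n / g (n + 1) <= 1 by rewrite ler_pdivrMr ?mul1r ?ltW.
  rewrite rem_term_le2// picone_gapE// sqrt_powR ?(ltW st0)//.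
  set x := (g n)^-1%:C * u n; set z := (_ - _)^-1%:C * _.
  have T0 : 0 <= (g (n + 1) - g n) `^ (p - 1) * g (n + 1).
    by rewrite mulr_ge0 ?powR_ge0 ?ltW.
  apply: le_trans (ler_wpM2l T0 (H _ x z (ltW st0) st1)).
  rewrite [leRHS]mulrCA picone_gap_weight// ler_wpM2l ?(ltW c0)//.
  rewrite ler_wpM2r ?mulr_ge0 ?powR_ge0//.
  by apply: ge1r_powR; rewrite ?st0//; lra.
have q2 : 2 < q by rewrite qE ltr_pdivlMr; lra.
have [c c0 H] := jensen_gap_lt2 p1 p2.
exists c^-1; first by rewrite invr_gt0.
move=> g u n g0 gS; rewrite ler_pdivlMl//.
have t0 : 0 < g (n + 1) by exact: lt_trans gS.
have st0 : 0 < g n / g (n + 1) by rewrite divr_gt0.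
have st1 : g n / g (n + 1) <= 1 by rewrite ler_pdivrMr ?mul1r ?ltW.
rewrite rem_term_gt2// picone_gapE//.
set x := (g n)^-1%:C * u n; set z := (_ - _)^-1%:C * _.
have T0 : 0 <= (g (n + 1) - g n) `^ (p - 1) * g (n + 1).
  by rewrite mulr_ge0 ?powR_ge0 ?ltW.
apply: le_trans (ler_wpM2l T0 (H _ x z (ltW st0) st1)).
by rewrite [leRHS]mulrCA picone_gap_weight.
Qed.

(** Now [p] selects the branch of the upper Jensen bound, and for [p <= 2] the prefactors compare
    the other way, [s/t <= (s/t)^(p/2)]. *)
Lemma picone_gap_le_rem_term (R : realType) (p : R) : 1 < p ->
  exists2 C, 0 < C & forall (g : int -> R) (u : int -> R[i]) (n : int),
    0 < g n -> g n < g (n + 1) ->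
    picone_gap p (g n) (g (n + 1)) (u n) (u (n + 1)) <= C * rem_term p p g u n.
Proof.
move=> p1; have [p2|p2] := leP p 2.
  have [c c0 H] := jensen_gap_le2 p1 p2.
  exists c => // g u n g0 gS.
  have t0 : 0 < g (n + 1) by exact: lt_trans gS.
  have st0 : 0 < g n / g (n + 1) by rewrite divr_gt0.
  have st1 : g n / g (n + 1) <= 1 by rewrite ler_pdivrMr ?mul1r ?ltW.
  rewrite rem_term_le2// picone_gapE// sqrt_powR ?(ltW st0)//.
  set x := (g n)^-1%:C * u n; set z := (_ - _)^-1%:C * _.
  have T0 : 0 <= (g (n + 1) - g n) `^ (p - 1) * g (n + 1).
    by rewrite mulr_ge0 ?powR_ge0 ?ltW.
  apply: le_trans (ler_wpM2l T0 (H _ x z (ltW st0) st1)) _.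
  rewrite [leLHS]mulrCA picone_gap_weight// ler_wpM2l ?(ltW c0)//.
  rewrite ler_wpM2r ?mulr_ge0 ?powR_ge0//.
  by apply: ger1_powR; rewrite ?st0//; lra.
have [c c0 H] := jensen_gap_gt2 p2.
exists c => // g u n g0 gS.
have t0 : 0 < g (n + 1) by exact: lt_trans gS.
have st0 : 0 < g n / g (n + 1) by rewrite divr_gt0.
have st1 : g n / g (n + 1) <= 1 by rewrite ler_pdivrMr ?mul1r ?ltW.
rewrite rem_term_gt2// picone_gapE//.
set x := (g n)^-1%:C * u n; set z := (_ - _)^-1%:C * _.
have T0 : 0 <= (g (n + 1) - g n) `^ (p - 1) * g (n + 1).
  by rewrite mulr_ge0 ?powR_ge0 ?ltW.
apply: le_trans (ler_wpM2l T0 (H _ x z (ltW st0) st1)) _.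
by rewrite [leLHS]mulrCA picone_gap_weight.
Qed.

(** * Finite supports and summation by parts *)

Lemma sum_from_fin (R : realType) (l N : nat) (f : nat -> R) : (l <= N)%N ->
  (forall n, (N <= n)%N -> f n = 0) -> sum_from l f = \sum_(l <= n < N) f n.
Proof.
move=> lN f0; apply: norm_lim_near_cst; near=> M.
have NM : (N <= M)%N by near: M; exact: nbhs_infty_ge.
rewrite (big_cat_nat lN NM) /= -[RHS]addr0; congr (_ + _).
by rewrite big_nat_cond big1// => i /andP[/andP[/f0]].
Unshelve. all: by end_near.
Qed.

Lemma C0_ubound (R : realType) (u : int -> R[i]) : C0 u ->
  exists M : nat, forall n : int, M%:Z <= n -> u n = 0.
Proof.
move=> /finite_seqP[s su].
exists (\max_(i <- s) `|i|%N).+1 => n Mn; apply/eqP; apply: contraT => un.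
have ns : n \in s by have : [set n | u n != 0] n by []; rewrite su.
have := @leq_bigmax_seq _ s xpredT (fun i : int => `|i|%N) n ns isT.
move: (\max_(i <- s) `|i|%N) Mn => M; lia.
Qed.

Lemma iter_nabla_low (V : zmodType) (k : nat) (u : int -> V) (c : int) :
  (forall n, n < c -> u n = 0) -> forall n, n < c -> iter k (@nabla V) u n = 0.
Proof.
move=> u0; elim: k => [|k IH] n nc //=; first exact: u0.
by rewrite /nabla !IH ?subrr//; lia.
Qed.

Lemma iter_nabla_high (V : zmodType) (k : nat) (u : int -> V) (M : nat) :
  (forall n : int, M%:Z <= n -> u n = 0) ->
  forall n : int, (M + k)%:Z <= n -> iter k (@nabla V) u n = 0.
Proof.
move=> u0; elim: k => [|k IH] n nc /=; first by apply: u0; lia.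
by rewrite /nabla !IH ?subrr//; lia.
Qed.

Lemma ReB (R : realType) (x y : R[i]) :
  complex.Re (x - y) = complex.Re x - complex.Re y.
Proof. by case: x => a b; case: y => c d. Qed.

Lemma modulus0 (R : realType) : modulus (0 : R[i]) = 0.
Proof. exact: ComplexField.Normc.normc0. Qed.

Lemma gt0_complexE (R : realType) (z : R[i]) : 0 < z ->
  z = (complex.Re z)%:C /\ 0 < complex.Re z.
Proof. by case: z => a b; rewrite ltcE /= => /andP[/eqP -> ->]. Qed.

Lemma ge0_Re (R : realType) (z : R[i]) : 0 <= z -> 0 <= complex.Re z.
Proof. by case: z => a b; rewrite lecE /= => /andP[]. Qed.

Lemma npLapS (R : realType) (p : R) (m : nat) (h : int -> R[i]) (n : int) :
  npLap p m.+1 h n = npLap p m (nabla h) n - npLap p m (nabla h) (n + 1).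
Proof. by rewrite /npLap exprS [iter m.+1 (@nabla _) h]iterSr iterS /sdiv; ring. Qed.

Lemma weight0 (R : realType) (p : R) (h : int -> R[i]) (n : int) : 1 < p ->
  0 < h n -> weight p 0 h n = 1.
Proof.
move=> p1 /gt0_complexE[hE h0]; rewrite /weight /npLap /= mul1r /spow hE.
rewrite modulus_real ?(ltW h0)// -rmorphM /= mulr_powRB1 ?(ltW h0)//; last by lra.
by rewrite divff// gt_eqF// powR_gt0.
Qed.

(* The boundary terms of the summation by parts vanish: at [l] because
   [nabla h l = h l] and [nabla v l = v l], at [N] because [v] has ended. *)
Lemma picone_sum (R : realType) (p : R) (m l N : nat) (h v : int -> R[i]) :
  1 < p -> (l <= N)%N ->
  (forall n : int, n < l%:Z -> h n = 0) -> (forall n : int, n < l%:Z -> v n = 0) ->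
  (forall n : int, N%:Z <= n + 1 -> v n = 0) ->
  (forall n : int, l%:Z <= n -> 0 < h n) ->
  (forall n : int, l%:Z <= n -> 0 < nabla h n) ->
  sum_from l (fun n => weight p m (nabla h) n%:Z * modulus (nabla v n%:Z) `^ p)
  - sum_from l (fun n => weight p m.+1 h n%:Z * modulus (v n%:Z) `^ p)
  = \sum_(l <= n < N) weight p m (nabla h) (n%:Z + 1) *
      picone_gap p (complex.Re (h n%:Z)) (complex.Re (h (n%:Z + 1)))
        (v n%:Z) (v (n%:Z + 1)).
Proof.
move=> p1 lN hl vl vN h0 dh0.
have pn0 : p != 0 by lra.
(* [v] vanishes already from [N - 1] on, so its backward difference vanishes from [N] on. *)
have dvN n : N%:Z <= n -> nabla v n = 0 by move=> nN; rewrite /nabla !vN ?subrr//; lia.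
rewrite (@sum_from_fin _ _ N)//; last first.
  by move=> n nN; rewrite dvN ?modulus0 ?powR0 ?mulr0//; lia.
rewrite (@sum_from_fin _ _ N)//; last first.
  by move=> n nN; rewrite vN ?modulus0 ?powR0 ?mulr0//; lia.
(* With [W = npLap p m (nabla h)], the left summand minus the right one is [X n - X (n + 1)]. *)
pose X (n : nat) := weight p m (nabla h) n%:Z * modulus (nabla v n%:Z) `^ p -
  complex.Re (npLap p m (nabla h) n%:Z) / complex.Re (h n%:Z) `^ (p - 1) *
    modulus (v n%:Z) `^ p.
apply/eqP; rewrite -subr_eq0 -!sumrB; apply/eqP.
rewrite (@telescope_sumr_eq _ l N (fun n => - X n))//; last first.
  move=> n /andP[ln nN].
  have lnZ : l%:Z <= n%:Z by lia.
  have [_ s0] := gt0_complexE (h0 _ lnZ).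
  have [_ ts0] := gt0_complexE (dh0 (n%:Z + 1) ltac:(lia)).
  have [_ t0] := gt0_complexE (h0 (n%:Z + 1) ltac:(lia)).
  rewrite /X /weight npLapS [complex.Re (npLap _ _ _ _ - _)]ReB /picone_gap -addn1 PoszD.
  have -> : nabla v (n%:Z + 1) = v (n%:Z + 1) - v n%:Z by rewrite /nabla addrK.
  have hE : complex.Re (nabla h (n%:Z + 1)) =
      complex.Re (h (n%:Z + 1)) - complex.Re (h n%:Z) by rewrite /nabla addrK ReB.
  rewrite hE; rewrite hE in ts0.
  have := powR_gt0 (p - 1) s0; have := powR_gt0 (p - 1) t0; have := powR_gt0 (p - 1) ts0.
  have := powR_gt0 (p - 1) (gt0_complexE (dh0 _ lnZ)).2.
  by move=> a0 b0 c0 d0; field; rewrite !gt_eqF.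
rewrite /= opprK /X /weight dvN// vN//; last by lia.
rewrite modulus0 powR0// !mulr0 subrr oppr0 add0r.
have -> : nabla v l = v l by rewrite /nabla (vl (l%:Z - 1)) ?subr0//; lia.
have -> : nabla h l = h l by rewrite {1}/nabla (hl (l%:Z - 1)) ?subr0//; lia.
exact: subrr.
Qed.

Lemma rem_term_zero (R : realType) (p s : R) (g : int -> R) (u : int -> R[i]) (n : int) :
  p != 0 -> u n = 0 -> u (n + 1) = 0 -> rem_term p s g u n = 0.
Proof.
move=> p0 u0 u1; rewrite /rem_term u0 u1 !mulr0 subrr modulus0 powR0// expr0n mul0r.
by rewrite if_same.
Qed.

(** * Telescoping over the order of the difference *)

Theorem theorem2p6 (R : realType) (l : nat) (p q : R) :
  (0 < l)%N -> 1 < p -> p^-1 + q^-1 = 1 ->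
  exists C1 C2 : R, 0 < C1 /\ 0 < C2 /\
    forall g : int -> R[i], Hl l g ->
      (forall (n : int) (k : nat), l%:Z <= n -> (k <= l)%N ->
         0 < iter k (@nabla R[i]) g n) ->
      (forall (n : int) (k : nat), l%:Z <= n -> (1 <= k <= l.-1)%N ->
         0 <= npLap p (l - k) (iter k (@nabla R[i]) g) n) ->
      forall u : int -> R[i], Hl0 l u ->
        \sum_(1 <= k < l.+1) remainder p l k q g u <= C1 * deficit p l g u /\
        deficit p l g u <= C2 * \sum_(1 <= k < l.+1) remainder p l k p g u.
Proof.
move=> l0 p1 pq.
have [C1 C1_gt0 lower] := rem_term_le_picone_gap p1 pq.
have [C2 C2_gt0 upper] := picone_gap_le_rem_term p1.
exists C1, C2; do 2!split=> //.
move=> g gl gpos glap u [ul /C0_ubound[M uM]].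
have pn0 : p != 0 by lra.
pose G k := iter k (@nabla R[i]) g; pose U k := iter k (@nabla R[i]) u.
(* Each difference extends the support by one to the right, so every [U k] with [k <= l] vanishes
   from [N - 1] on. *)
pose N := (M + l + l).+1.
have lN : (l <= N)%N by rewrite /N; lia.
have UN k (n : int) : (k <= l)%N -> N%:Z <= n + 1 -> U k n = 0.
  by move=> kl nN; apply: (iter_nabla_high uM); rewrite /N in nN; lia.
(* [E] interpolates between the two sums of the deficit: [E l] has weight 1 and is the sum of
   [|nabla^l u|^p], [E 0] is the weighted sum of [|u|^p], and [P k = E (k+1) - E k]. *)
pose E k := sum_from l (fun n => weight p (l - k) (G k) n%:Z * modulus (U k n%:Z) `^ p).
pose P k := \sum_(l <= n < N) weight p (l - k.+1) (G k.+1) (n%:Z + 1) *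
  picone_gap p (complex.Re (G k n%:Z)) (complex.Re (G k (n%:Z + 1)))
    (U k n%:Z) (U k (n%:Z + 1)).
have deficitE : deficit p l g u = \sum_(0 <= k < l) P k.
  rewrite (@telescope_sumr_eq _ 0 l E)//; last first.
    move=> k kl; rewrite /E (_ : (l - k)%N = (l - k.+1).+1); last by lia.
    symmetry; apply: picone_sum => //.
    - exact: iter_nabla_low.
    - exact: iter_nabla_low.
    - by move=> n; apply: UN; lia.
    - by move=> n ln; apply: gpos; lia.
    - by move=> n ln; apply: (gpos n k.+1); lia.
  rewrite /deficit /E subn0 subnn; congr (_ - _).
  rewrite !(@sum_from_fin _ _ N)//.
  - apply: eq_big_nat => n /andP[ln _]; rewrite weight0 ?mul1r//.
    by apply: gpos; lia.
  - by move=> n nN; rewrite UN ?modulus0 ?powR0 ?mulr0//; lia.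
  - by move=> n nN; rewrite -/(U l n) UN ?modulus0 ?powR0//; lia.
have remainderE s k : (k < l)%N -> remainder p l k.+1 s g u =
    \sum_(l <= n < N) weight p (l - k.+1) (G k.+1) (n%:Z + 1) *
      rem_term p s (fun j => complex.Re (G k j)) (U k) n%:Z.
  move=> kl; apply: sum_from_fin => // n nN.
  by rewrite rem_term_zero ?mulr0//; apply: UN; lia.
have w0 k (n : nat) : (k < l)%N -> (l <= n)%N -> 0 <= weight p (l - k.+1) (G k.+1) (n%:Z + 1).
  (* At the top order [k + 1 = l] the weight is 1; at lower orders its sign is the hypothesis on the
     p-Laplacians. *)
  move=> kl ln; have [->|kl'] := eqVneq k.+1 l.
    by rewrite subnn weight0// ; apply: gpos; lia.
  by rewrite divr_ge0 ?powR_ge0//; apply: ge0_Re; apply: glap; lia.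
have Gincr k (n : nat) : (k < l)%N -> (l <= n)%N ->
    0 < complex.Re (G k n%:Z) /\ complex.Re (G k n%:Z) < complex.Re (G k (n%:Z + 1)).
  (* Strict growth of [G k] from [n] to [n + 1] is positivity of the next difference at [n + 1]. *)
  move=> kl ln; have [_ ?] := gt0_complexE (gpos n%:Z k ltac:(lia) ltac:(lia)).
  split=> //; have [_] := gt0_complexE (gpos (n%:Z + 1) k.+1 ltac:(lia) kl).
  by rewrite iterS /nabla addrK ReB subr_gt0.
rewrite !big_add1 /= deficitE !mulr_sumr !big_nat.
split; apply: ler_sum => k /andP[_ kl]; rewrite remainderE// /P mulr_sumr !big_nat.
- apply: ler_sum => n /andP[ln _]; have [? ?] := Gincr k n kl ln.
  by rewrite mulrCA ler_wpM2l ?w0//; exact: (lower (fun j => complex.Re (G k j))).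
- apply: ler_sum => n /andP[ln _]; have [? ?] := Gincr k n kl ln.
  by rewrite mulrCA ler_wpM2l ?w0//; exact: (upper (fun j => complex.Re (G k j))).
Qed.
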